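(* Let $c$ be admissible and let $(m_1,n_1,p_1)$ be the minimal triple of $c$. Put $m_0=1$, $p_0=0$, and for $k\ge1$ $$m_k=m_1m_{k-1}+c^2p_1p_{k-1},\qquad p_k=m_1p_{k-1}+p_1m_{k-1},\qquad n_k=\frac{m_k^2-1}{p_k}.$$ Then for every $k\ge1$, $(m_k,n_k,p_k)$ is the $k$-th triple of $c$, and it corresponds to the $k$-th term $(-V_k,V_k)$ of the spectrum of $c$, where $V_k=\frac{n_k}{m_k}$.
   Context: Let $\mathbb{N}=\{1,2,\dots\}$. A pair of real numbers $(V,c)$ with $0<|V|<c$ is called admissible if the linear map of $\mathbb{R}^2$ $(x,t)\mapsto\left(\frac{x-Vt}{\sqrt{1-V^2/c^2}},\frac{t-\frac{V}{c^2}x}{\sqrt{1-V^2/c^2}}\right)$ is the lift of a homeomorphism of $T^2=\mathbb{R}^2/\mathbb{Z}^2$. A number $c>0$ is admissible if $(V,c)$ is admissible for some $V$; the spectrum of $c$ is the set of all $V$ with $(V,c)$ admissible. It is symmetric about $0$, and its positive part is listed in increasing order as $V_1<V_2<\cdots$. Each admissible pair $(V,c)$ with $V>0$ corresponds to a unique triple $(m,n,p)$ with $m^2-np=1$, $m\ge2$, $n,p\in\mathbb{N}$, via $c=\sqrt{n/p}$, $V=n/m$, and conversely every such triple gives an admissible pair. The triples of $c$ are those with $\sqrt{n/p}=c$. Triples are partially ordered by $(m,n,p)<(m',n',p')$ iff $m<m'$, $n<n'$, $p<p'$. The triples of a fixed $c$ are totally ordered by this relation, in the same order as the corresponding $V_k$;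 the minimal triple of $c$ is the first one and the $k$-th triple is the one corresponding to $V_k$. *)

(* Defs.v *)
From HB Require Import structures.
From mathcomp Require Import all_boot all_order all_algebra.
From mathcomp Require Import all_classical all_reals all_analysis.
Set Implicit Arguments.
Unset Strict Implicit.
Unset Printing Implicit Defensive.
Import Order.TTheory GRing.Theory Num.Theory.
Import numFieldNormedType.Exports.
Local Open Scope classical_set_scope.
Local Open Scope ring_scope.
Local Open Scope quotient_scope.
Local Open Scope card_scope.

Section Torus.
Variable R : realType.

Definition torus_rel (v w : R * R) : bool :=
  (v.1 - w.1 \is a Num.int) && (v.2 - w.2 \is a Num.int).

Lemma torus_rel_refl : reflexive torus_rel.
Proof. by move=> v; rewrite /torus_rel !subrr !rpred0. Qed.

Lemma torus_rel_sym : symmetric torus_rel.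
Proof. by move=> v w; rewrite /torus_rel -rpredN opprB -[X in _ && X]rpredN opprB. Qed.

Lemma torus_rel_trans : transitive torus_rel.
Proof.
move=> w v u /andP[vw1 vw2] /andP[wu1 wu2]; apply/andP; split.
- by rewrite -(subrK w.1 v.1) -addrA rpredD.
- by rewrite -(subrK w.2 v.2) -addrA rpredD.
Qed.

Canonical torus_equiv :=
  EquivRel torus_rel torus_rel_refl torus_rel_sym torus_rel_trans.

(* T^2 = R^2 / Z^2 with the quotient of the product topology. *)
Definition torus := quotient_topology {eq_quot torus_rel}.

Definition torus_proj (v : R * R) : torus := \pi_torus v.

End Torus.

Definition homeomorphism (X Y : topologicalType) (f : X -> Y) : Prop :=
  continuous f /\
  exists g : Y -> X, [/\ continuous g, cancel f g & cancel g f].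

Definition is_lift (R : realType) (F : R * R -> R * R)
    (f : torus R -> torus R) : Prop :=
  continuous F /\ forall v, torus_proj (F v) = f (torus_proj v).

Definition lorentz (R : realType) (V c : R) (v : R * R) : R * R :=
  let s := Num.sqrt (1 - V ^+ 2 / c ^+ 2) in
  ((v.1 - V * v.2) / s, (v.2 - V / c ^+ 2 * v.1) / s).

Definition admissible_pair (R : realType) (V c : R) : Prop :=
  [/\ 0 < `|V|, `|V| < c &
      exists f : torus R -> torus R, homeomorphism f /\ is_lift (lorentz V c) f].

Definition admissible (R : realType) (c : R) : Prop :=
  0 < c /\ exists V, admissible_pair V c.

Definition spectrum (R : realType) (c : R) : set R :=
  [set V | admissible_pair V c].

(* [x] is the [k]-th element ([k >= 1]) of [A] listed in increasing order:
   it is comparable to every other element of [A], and exactly [k - 1]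
   elements of [A] precede it. *)
Definition kth_element (T : Type) (lt : T -> T -> Prop) (A : set T)
    (k : nat) (x : T) : Prop :=
  [/\ (1 <= k)%N, A x,
      forall y, A y -> [\/ y = x, lt y x | lt x y] &
      [set y | A y /\ lt y x] #= `I_k.-1].

Definition kth_positive (R : realType) (c : R) (k : nat) (V : R) : Prop :=
  kth_element (fun x y : R => x < y) (spectrum c `&` [set x | 0 < x]) k V.

Definition kth_spectrum_term (R : realType) (c : R) (k : nat) (W : R * R)
    : Prop :=
  [/\ W.1 = - W.2, spectrum c W.1 & kth_positive c k W.2].

Definition is_triple (t : nat * nat * nat) : Prop :=
  let: (m, n, p) := t in
  [/\ (m ^ 2)%:Z - (n * p)%:Z = 1 :> int, (2 <= m)%N, (1 <= n)%N & (1 <= p)%N].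

Definition triple_lt (t t' : nat * nat * nat) : Prop :=
  let: (m, n, p) := t in
  let: (m', n', p') := t' in
  [/\ (m < m')%N, (n < n')%N & (p < p')%N].

Definition triples_of (R : realType) (c : R) : set (nat * nat * nat) :=
  [set t | is_triple t /\
     let: (_, n, p) := t in Num.sqrt (n%:R / p%:R : R) = c].

Definition corresponds (R : realType) (t : nat * nat * nat) (V c : R) : Prop :=
  triples_of c t /\ let: (m, n, _) := t in V = n%:R / m%:R.

Definition minimal_triple (R : realType) (c : R) (t : nat * nat * nat) : Prop :=
  triples_of c t /\ forall t', triples_of c t' -> ~ triple_lt t' t.

(* The [k]-th triple of [c]: [k]-th for the order on triples, and the one
   corresponding to the [k]-th positive element of the spectrum. *)
Definition kth_triple (R : realType) (c : R) (k : nat) (t : nat * nat * nat)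
    : Prop :=
  kth_element triple_lt (triples_of c) k t /\
  exists V : R, kth_positive c k V /\ corresponds t V c.

(* Main.v *)
Require Import Defs.
From mathcomp Require Import all_boot all_order all_algebra.
From mathcomp Require Import all_classical all_reals all_analysis.
From mathcomp Require Import zify ring.
Set Implicit Arguments.
Unset Strict Implicit.
Unset Printing Implicit Defensive.
Import Order.TTheory GRing.Theory Num.Theory.
Import numFieldNormedType.Exports.
Local Open Scope classical_set_scope.
Local Open Scope ring_scope.


(** In the variables m = gamma, n = gamma V and p = gamma V / c^2, where
    gamma = 1 / sqrt (1 - V^2 / c^2), the Lorentz map is the matrix
    [[m, -n], [-p, m]], of determinant m^2 - n p = 1.  It is the lift of a map
    of the torus exactly when m, n and p are integers: a lift sends the lattice
    to a single class modulo Z^2 ([admissible_triple]), and conversely an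
    integral matrix of determinant 1 and its inverse [[m, n], [p, m]] both
    descend to the quotient ([boost_lift]).  Hence the positive part of the
    spectrum of c is the set of quotients n / m over the triples of c.

    For fixed c every triple has n = c^2 p, so the triples of c are the
    solutions of the Pell-type equation m^2 - c^2 p^2 = 1 with p > 0 and c^2 p
    an integer.  They multiply as the numbers m + c p, and the recursion of the
    theorem is multiplication by the minimal solution.  Every solution is a
    power of the minimal one: dividing a solution with p > p_1 by the minimal
    one gives a solution with a smaller, still positive, p ([triple_descent]),
    so the division stops at the minimal solution itself
    ([triples_of_pow]).  Multiplication by the minimal solution increases m, n,
    p ([triple_lt_mul]) and the quotient n / m ([speed_lt_mul]), so the
    sequence of powers lists both the triples and the positive spectrum in
    increasing order, and [kth_element_enum] reads off the rank of each. *)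

(** * Sets enumerated in increasing order *)

(** The predecessors of [e k] are exactly [e 0], ..., [e k.-1], and these are
    pairwise distinct.  Indices start at 0, ranks at 1. *)
Lemma kth_element_enum (T : Type) (lt : T -> T -> Prop) (A : set T)
    (e : nat -> T) :
  (forall x, ~ lt x x) -> (forall y x z, lt x y -> lt y z -> lt x z) ->
  (forall i, lt (e i) (e i.+1)) ->
  (forall x, A x <-> exists i, x = e i) ->
  forall k, kth_element lt A k.+1 (e k).
Proof.
move=> irr tr step AE k.
have mono i j : (i < j)%N -> lt (e i) (e j) by exact: (homo_ltn tr step).
split=> //; first by apply/AE; exists k.
  move=> y /AE[i ->]; case: (ltngtP i k) => [ik|ki|->].
  - by apply: Or32; exact: mono.
  - by apply: Or33; exact: mono.
  - exact: Or31.
rewrite (_ : [set y | _]%classic = (e @` `I_k)%classic); last first.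
  apply/seteqP; split=> [y [/AE[i ->] ik]|_ [i /= ik <-]] /=.
    exists i => //=; case: (ltngtP i k) ik => // [ki|->] ik.
      by case: (irr (e i)); apply: tr ik (mono _ _ ki).
    by case: (irr (e k)).
  by split; [apply/AE; exists i | exact: mono].
apply: inj_card_eq => i j _ _ eij.
by case: (ltngtP i j) => // /mono; rewrite eij => /irr.
Qed.

(** * Solutions of the Pell-type equation *)

(** The product n p is m^2 - 1 >= 3, which forces n and p to be positive. *)
Lemma is_tripleE m n p :
  is_triple (m, n, p) <-> (m ^ 2 = (n * p).+1)%N /\ (2 <= m)%N.
Proof.
rewrite /is_triple; split=> [[e m2 _ _]|[e m2]].
  by split=> //; lia.
have np : (n * p != 0)%N by apply/eqP => np0; move: e; rewrite np0; nia.
split=> //; first (by lia); move: np; rewrite muln_eq0 negb_or -!lt0n => /andP[] //.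
Qed.

(** This is the product (m + c p) (m' + c p') when n = c^2 p and n' = c^2 p';
    it is also the product of the matrices [[m, n], [p, m]]. *)
Definition triple_mul (t t' : nat * nat * nat) : nat * nat * nat :=
  let: (m, n, p) := t in
  let: (m', n', p') := t' in
  (m * m' + n * p', m * n' + n * m', m * p' + p * m')%N.

Definition triple_pow (t : nat * nat * nat) (k : nat) : nat * nat * nat :=
  iter k (triple_mul t) (1, 0, 0)%N.

(** The second equation says that [t] has the same c^2 = n / p as [r], without
    division.  It leaves room for the unit (1, 0, 0), the zeroth power, for which
    n / p has no meaning. *)
Definition pell_solution (r t : nat * nat * nat) : Prop :=
  let: (_, n1, p1) := r in
  let: (m, n, p) := t in
  (m ^ 2 = (n * p).+1 /\ n * p1 = n1 * p)%N.

(** Multiplicativity of the norm m^2 - c^2 p^2; the proportionality makes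
    (n1 p)^2 equal to (n1 p1) (n p). *)
Lemma pell_solution_mul t1 t : pell_solution t1 t1 ->
  pell_solution t1 t -> pell_solution t1 (triple_mul t1 t).
Proof.
case: t1 t => [[m1 n1] p1] [[m n] p] /= [e1 _] [e q]; split; last by nia.
suff : ((m1 * m + n1 * p) ^ 2)%N%:Z
  = ((m1 * n + n1 * m) * (m1 * p + p1 * m)).+1%N%:Z :> int by case.
have E1 : m1%:Z ^+ 2 = n1%:Z * p1%:Z + 1 by lia.
have E : m%:Z ^+ 2 = n%:Z * p%:Z + 1 by lia.
have Q : n%:Z * p1%:Z = n1%:Z * p%:Z by lia.
have Q2 : (n1%:Z * p%:Z) * (n1%:Z * p%:Z) = n1%:Z * p1%:Z * (n%:Z * p%:Z).
  by rewrite -{1}Q; ring.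
rewrite -addn1 -mulnn !(PoszD, PoszM).
transitivity (m1%:Z ^+ 2 * m%:Z ^+ 2 + m1%:Z * m%:Z * n1%:Z * p%:Z *+ 2
   + (n1%:Z * p%:Z) * (n1%:Z * p%:Z)); first by ring.
rewrite Q2.
transitivity (m1%:Z ^+ 2 * (n%:Z * p%:Z) + m1%:Z * m%:Z * (n1%:Z * p%:Z)
   + m1%:Z * m%:Z * (n%:Z * p1%:Z) + m%:Z ^+ 2 * (n1%:Z * p1%:Z) + 1); last by ring.
rewrite E1 E Q; ring.
Qed.

Lemma pell_solution_pow t1 k : pell_solution t1 t1 ->
  pell_solution t1 (triple_pow t1 k).
Proof.
move=> s1; elim: k => [|k IH]; last exact: pell_solution_mul.
by case: t1 s1 => [[m1 n1] p1] _ /=; split; rewrite ?muln0.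
Qed.

Lemma triple_lt_mul t1 t : is_triple t1 -> (0 < t.1.1)%N ->
  triple_lt t (triple_mul t1 t).
Proof.
case: t1 t => [[m1 n1] p1] [[m n] p] [_ m1_2 n1_0 p1_0] /= m_0.
have m1_0 : (0 < m1)%N by exact: ltnW.
split; first by rewrite ltn_addr // ltn_Pmull.
  by rewrite -addn1 leq_add ?leq_pmull ?muln_gt0 ?n1_0.
by rewrite -addn1 leq_add ?leq_pmull ?muln_gt0 ?p1_0.
Qed.

Lemma triple_pow_gt0 t1 k : is_triple t1 -> (0 < (triple_pow t1 k).1.1)%N.
Proof.
move=> T1; elim: k => // k IH; rewrite /triple_pow iterS.
have := triple_lt_mul T1 IH; case: (triple_mul _ _) => [[m' n'] p'].
rewrite /triple_pow; case: (iter _ _ _) => [[m n] p] /= [mm _ _].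
exact: leq_ltn_trans mm.
Qed.

Lemma triple_lt_pow t1 k : is_triple t1 ->
  triple_lt (triple_pow t1 k) (triple_pow t1 k.+1).
Proof. by move=> T1; apply: triple_lt_mul => //; exact: triple_pow_gt0. Qed.

Lemma triple_lt_irr t : ~ triple_lt t t.
Proof. by case: t => [[m n] p] []; rewrite ltnn. Qed.

Lemma triple_lt_trans t' t t'' :
  triple_lt t t' -> triple_lt t' t'' -> triple_lt t t''.
Proof.
case: t t' t'' => [[m n] p] [[m' n'] p'] [[m'' n''] p''] /=.
by move=> [? ? ?] [? ? ?]; split; apply: ltn_trans; eassumption.
Qed.

Lemma is_triple_pow t1 k : is_triple t1 -> is_triple (triple_pow t1 k.+1).
Proof.
move=> T1; have := triple_lt_pow k T1; have := triple_pow_gt0 k T1.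
have : pell_solution t1 t1.
  by case: t1 T1 => [[m1 n1] p1] /is_tripleE[].
move=> /(@pell_solution_pow _ k.+1).
case: (triple_pow t1 k.+1) => [[m' n'] p'].
case: (triple_pow t1 k) => [[m n] p] /=.
case: t1 {T1} => [[m1 n1] p1] [e _] m0 [mm _ _].
by apply/is_tripleE; split=> //; apply: leq_ltn_trans mm.
Qed.

(** The inverse of m1 + c p1 is m1 - c p1, so the quotient of t by t1 is
    (m1 m - n1 p, m1 n - n1 m, m1 p - p1 m).  Its entries are positive because
    p > p1, and its last entry is smaller than p because m1 > 1.  Squaring the
    inequalities on the first and last entries removes the irrational c; the one
    on the second entry follows by proportionality. *)
Lemma triple_descent t1 t : is_triple t1 -> is_triple t -> pell_solution t1 t ->
  (t1.2 < t.2)%N ->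
  exists t', [/\ is_triple t', pell_solution t1 t', (t'.2 < t.2)%N
    & t = triple_mul t1 t'].
Proof.
case: t1 t => [[m1 n1] p1] [[m n] p] T1 T /= [_ q] lp.
have /is_tripleE[e1 m1_2] := T1; have /is_tripleE[e m_2] := T.
case: T1 => _ _ n1_0 p1_0; case: T => _ _ n_0 p_0.
have Q : n%:Z * p1%:Z = n1%:Z * p%:Z by lia.
have Q2 : (n1%:Z * p%:Z) * (n1%:Z * p%:Z) = n1%:Z * p1%:Z * (n%:Z * p%:Z).
  by rewrite -{1}Q; ring.
have E1 : m1%:Z ^+ 2 = n1%:Z * p1%:Z + 1 by lia.
have E : m%:Z ^+ 2 = n%:Z * p%:Z + 1 by lia.
(* (n1 p)^2 = (m1^2 - 1) (m^2 - 1) *)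
have lm : (n1 * p < m1 * m)%N.
  rewrite -ltn_sqr !expnMn e1 e -!mulnn.
  rewrite (_ : n1 * n1 * (p * p) = n1 * p1 * (n * p))%N.
    by move: (n1 * p1)%N (n * p)%N => a b; nia.
  by rewrite mulnACA -{1}q; nia.
(* (m1 p)^2 - (p1 m)^2 = p^2 - p1^2 *)
have lp' : (p1 * m < m1 * p)%N.
  rewrite -ltn_sqr !expnMn e1 e -!mulnn.
  have E2 : (p1 * n = n1 * p)%N by lia.
  have -> : (p1 * p1 * (n * p).+1 = p1 * p1 + n1 * p1 * (p * p))%N by nia.
  by rewrite mulSn ltn_add2r; nia.
have ln : (n1 * m < m1 * n)%N by rewrite -(ltn_pmul2r p1_0); nia.
have lpp : (m1 * p < p + p1 * m)%N.
  (* (m1 - 1)^2 p^2 <= (m1^2 - 1) p^2 = (p1 m)^2 - p1^2 *)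
  suff : (m1.-1 * p < p1 * m)%N by nia.
  rewrite -ltn_sqr !expnMn e.
  have -> : (p1 ^ 2 * (n * p).+1 = p1 ^ 2 + (n1 * p1) * p ^ 2)%N.
    rewrite mulnS; congr addn; rewrite -!mulnn.
    by transitivity ((n * p1) * p1 * p)%N; [|rewrite q]; nia.
  have : (m1.-1 ^ 2 <= n1 * p1)%N by nia.
  by rewrite -(leq_pmul2r (_ : 0 < p ^ 2)%N); nia.
have [m' mE] : exists m', (m1 * m = n1 * p + m')%N.
  by exists (m1 * m - n1 * p)%N; rewrite subnKC // ltnW.
have [n' nE] : exists n', (m1 * n = n1 * m + n')%N.
  by exists (m1 * n - n1 * m)%N; rewrite subnKC // ltnW.
have [p' pE] : exists p', (m1 * p = p1 * m + p')%N.
  by exists (m1 * p - p1 * m)%N; rewrite subnKC // ltnW.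
have n'0 : (0 < n')%N by move: ln; rewrite nE; lia.
have p'0 : (0 < p')%N by move: lp'; rewrite pE; lia.
have mZ : m'%:Z = m1%:Z * m%:Z - n1%:Z * p%:Z by lia.
have nZ : n'%:Z = m1%:Z * n%:Z - n1%:Z * m%:Z by lia.
have pZ : p'%:Z = m1%:Z * p%:Z - p1%:Z * m%:Z by lia.
have e' : (m' ^ 2 = (n' * p').+1)%N.
  suff : m'%:Z ^+ 2 = n'%:Z * p'%:Z + 1 by lia.
  rewrite mZ nZ pZ.
  transitivity (m1%:Z ^+ 2 * m%:Z ^+ 2 - m1%:Z * m%:Z * n1%:Z * p%:Z *+ 2
    + (n1%:Z * p%:Z) * (n1%:Z * p%:Z)); first by ring.
  rewrite Q2.
  transitivity (m1%:Z ^+ 2 * (n%:Z * p%:Z) - m1%:Z * m%:Z * (n1%:Z * p%:Z)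
    - m1%:Z * m%:Z * (n%:Z * p1%:Z) + m%:Z ^+ 2 * (n1%:Z * p1%:Z) + 1); last by ring.
  by rewrite E1 E Q; ring.
exists (m', n', p'); split.
- by apply/is_tripleE; split=> //; rewrite -ltn_sqr e' ltnS muln_gt0 n'0.
- split=> //; suff : n'%:Z * p1%:Z = n1%:Z * p'%:Z by lia.
  rewrite nZ pZ mulrBl mulrBr -!mulrA Q; ring.
- by rewrite /= -(ltn_add2l (p1 * m)) -pE addnC.
- congr (_, _, _).
  + suff : m%:Z = m1%:Z * m'%:Z + n1%:Z * p'%:Z by lia.
    rewrite mZ pZ.
    transitivity (m%:Z * (m1%:Z ^+ 2 - n1%:Z * p1%:Z)); last by ring.
    by rewrite E1; ring.
  + suff : n%:Z = m1%:Z * n'%:Z + n1%:Z * m'%:Z by lia.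
    rewrite mZ nZ.
    transitivity (m1%:Z ^+ 2 * n%:Z - n1%:Z * (n1%:Z * p%:Z)); last by ring.
    by rewrite -Q E1; ring.
  + suff : p%:Z = m1%:Z * p'%:Z + p1%:Z * m'%:Z by lia.
    rewrite mZ pZ.
    transitivity (p%:Z * (m1%:Z ^+ 2 - n1%:Z * p1%:Z)); last by ring.
    by rewrite E1; ring.
Qed.

(** * Integral Lorentz maps and the torus *)

Definition boost (R : realType) (m n p : R) (v : R * R) : R * R :=
  (m * v.1 - n * v.2, m * v.2 - p * v.1).

Lemma torus_projP (R : realType) (v w : R * R) :
  reflect (torus_proj v = torus_proj w) (torus_rel v w).
Proof. exact: (@eqmodP _ (torus_equiv R)). Qed.

Lemma boost_continuous (R : realType) (m n p : R) : continuous (boost m n p).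
Proof.
move=> v.
have c1 : (m * w.1 - n * w.2) @[w --> v] --> m * v.1 - n * v.2.
  by apply: cvgB; apply: cvgMl_tmp; [exact: cvg_fst | exact: cvg_snd].
have c2 : (m * w.2 - p * w.1) @[w --> v] --> m * v.2 - p * v.1.
  by apply: cvgB; apply: cvgMl_tmp; [exact: cvg_snd | exact: cvg_fst].
exact: cvg_pair c1 c2.
Qed.

Lemma boost_torus_rel (R : realType) (m n p : R) (v w : R * R) :
  m \is a Num.int -> n \is a Num.int -> p \is a Num.int ->
  torus_rel v w -> torus_rel (boost m n p v) (boost m n p w).
Proof.
move=> mZ nZ pZ /andP[vw1 vw2]; apply/andP; split=> /=.
  rewrite (_ : _ - _ = m * (v.1 - w.1) - n * (v.2 - w.2)); last by ring.
  by rewrite rpredB ?rpredM.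
rewrite (_ : _ - _ = m * (v.2 - w.2) - p * (v.1 - w.1)); last by ring.
by rewrite rpredB ?rpredM.
Qed.

(** By the determinant condition the inverse of a boost is the boost with n
    and p negated, that is, with velocity -V. *)
Lemma boostK (R : realType) (m n p : R) : m ^+ 2 - n * p = 1 ->
  cancel (boost m n p) (boost m (- n) (- p)).
Proof.
move=> d [x t]; rewrite /boost /=; congr (_, _).
  by rewrite -[RHS]mul1r -d; ring.
by rewrite -[RHS]mul1r -d; ring.
Qed.

(** Descent to the quotient uses a representative; [torus_boostE] shows that
    integrality makes the choice irrelevant. *)
Definition torus_boost (R : realType) (m n p : R) (q : torus R) : torus R :=
  torus_proj (boost m n p (repr q)).

Lemma torus_boostE (R : realType) (m n p : R) (v : R * R) :
  m \is a Num.int -> n \is a Num.int -> p \is a Num.int ->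
  torus_boost m n p (torus_proj v) = torus_proj (boost m n p v).
Proof.
move=> mZ nZ pZ; apply/torus_projP; apply: boost_torus_rel => //.
by apply/torus_projP; rewrite /torus_proj reprK.
Qed.

Lemma torus_boost_continuous (R : realType) (m n p : R) :
  m \is a Num.int -> n \is a Num.int -> p \is a Num.int ->
  continuous (torus_boost m n p).
Proof.
move=> mZ nZ pZ; apply/quotient_continuous.
rewrite (_ : _ \o _ = @torus_proj R \o boost m n p); last first.
  by apply/funext => v; exact: torus_boostE.
move=> v; apply: continuous_comp; first exact: boost_continuous.
exact: pi_continuous.
Qed.

Lemma boost_lift (R : realType) (m n p : R) :
  m \is a Num.int -> n \is a Num.int -> p \is a Num.int ->
  m ^+ 2 - n * p = 1 ->
  exists f : torus R -> torus R, homeomorphism f /\ is_lift (boost m n p) f.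
Proof.
move=> mZ nZ pZ d.
have d' : m ^+ 2 - (- n) * (- p) = 1 by rewrite mulrNN.
have nZ' : - n \is a Num.int by rewrite rpredN.
have pZ' : - p \is a Num.int by rewrite rpredN.
exists (torus_boost m n p); split; last first.
  by split=> [|v]; [exact: boost_continuous | rewrite torus_boostE].
split; first exact: torus_boost_continuous.
exists (torus_boost m (- n) (- p)); split; first exact: torus_boost_continuous.
  move=> q; rewrite -[q in LHS]reprK [X in torus_boost m n p X](_ : _ = torus_proj (repr q)) //.
  by rewrite !torus_boostE // boostK // /torus_proj reprK.
move=> q; rewrite -[q in LHS]reprK [X in torus_boost m (- n) _ X](_ : _ = torus_proj (repr q)) //.
rewrite !torus_boostE // -{1}(opprK n) -{1}(opprK p) boostK // /torus_proj reprK //.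
Qed.

(** Here n and p may also be both negative, so that both velocities n / m and
    - n / m of a triple are covered. *)
Lemma lorentz_boost (R : realType) (m n p c : R) :
  0 < m -> n != 0 -> p != 0 -> c ^+ 2 = n / p -> m ^+ 2 - n * p = 1 ->
  lorentz (n / m) c = boost m n p.
Proof.
move=> m0 n0 p0 c2 d; have mN0 : m != 0 by rewrite gt_eqF.
have s : Num.sqrt (1 - (n / m) ^+ 2 / c ^+ 2) = m^-1.
  rewrite c2 (_ : 1 - _ = m^-1 ^+ 2); first by rewrite sqrtr_sqr gtr0_norm ?invr_gt0.
  transitivity ((m ^+ 2 - n * p) / m ^+ 2); first by field; rewrite mN0 n0 p0.
  by rewrite d div1r exprVn.
apply/funext => v; rewrite /lorentz /boost s invrK c2; congr (_, _).
  by field.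
by field; rewrite n0 mN0 p0.
Qed.

(** The boolean selects the sign of the velocity.  The bound V < c is
    c^2 - V^2 = c^2 / m^2 > 0. *)
Lemma triple_admissible (R : realType) (c : R) m n p :
  triples_of c (m, n, p) ->
  [/\ 0 < c, c ^+ 2 = n%:R / p%:R & forall b : bool,
      admissible_pair ((-1) ^+ b * (n%:R / m%:R)) c].
Proof.
move=> [[e m2 n1 p1] cE].
have m0 : 0 < m%:R :> R by rewrite ltr0n (leq_trans _ m2).
have n0 : 0 < n%:R :> R by rewrite ltr0n.
have p0 : 0 < p%:R :> R by rewrite ltr0n.
have d : m%:R ^+ 2 - n%:R * p%:R = 1 :> R.
  have -> : (m%:R ^+ 2 : R) = (n * p).+1%:R.
    by rewrite -natrX; congr (_%:R); lia.
  by rewrite -natr1 natrM; ring.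
have c2 : c ^+ 2 = n%:R / p%:R by rewrite -cE sqr_sqrtr // ltW ?divr_gt0.
have c0 : 0 < c by rewrite -cE sqrtr_gt0 divr_gt0.
split=> // b.
have V0 : 0 < n%:R / m%:R :> R by rewrite divr_gt0.
split.
- by rewrite normrM normr_sign mul1r gtr0_norm.
- rewrite normrM normr_sign mul1r gtr0_norm // -ltr_sqr ?nnegrE ?ltW //.
  rewrite c2 -subr_gt0 (_ : _ - _ = n%:R / p%:R / m%:R ^+ 2).
    by rewrite !divr_gt0 ?exprn_gt0.
  transitivity (n%:R * (m%:R ^+ 2 - n%:R * p%:R) / p%:R / m%:R ^+ 2 : R).
    by field; rewrite !gt_eqF.
  by rewrite d mulr1.
- rewrite mulrA (@lorentz_boost _ m%:R ((-1) ^+ b * n%:R) ((-1) ^+ b * p%:R)) //.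
  + apply: boost_lift; rewrite ?rpredM ?rpred_sign ?rpred_nat //.
    by rewrite mulrACA -expr2 sqrr_sign mul1r.
  + by rewrite mulf_neq0 ?signr_eq0 // gt_eqF.
  + by rewrite mulf_neq0 ?signr_eq0 // gt_eqF.
  + by rewrite -mulf_div divff ?signr_eq0 // mul1r.
  + by rewrite mulrACA -expr2 sqrr_sign mul1r.
Qed.

(** A lift sends points that are congruent modulo Z^2 to congruent points.
    Comparing the images of (1, 0) and (0, 1) with that of the origin shows that
    1 / s, V / s and V / (c^2 s), where s = sqrt (1 - V^2 / c^2), are integers. *)
Lemma admissible_triple (R : realType) (c V : R) :
  0 < V -> admissible_pair V c ->
  exists m n p, triples_of c (m, n, p) /\ V = n%:R / m%:R.
Proof.
move=> V0 [_ Vc [f [_ [_ lift]]]]; rewrite gtr0_norm // in Vc.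
have c0 : 0 < c := lt_trans V0 Vc.
pose s := Num.sqrt (1 - V ^+ 2 / c ^+ 2).
have r0 : 0 < 1 - V ^+ 2 / c ^+ 2.
  by rewrite subr_gt0 ltr_pdivrMr ?exprn_gt0 // mul1r ltr_sqr // nnegrE ltW.
have s0 : 0 < s by rewrite sqrtr_gt0.
have s2 : s ^+ 2 = 1 - V ^+ 2 / c ^+ 2 by rewrite sqr_sqrtr // ltW.
have lat v : torus_rel v (0, 0) ->
    torus_rel (lorentz V c v) (lorentz V c (0, 0)).
  by move=> /torus_projP vE; apply/torus_projP; rewrite !lift vE.
have /lat/andP[/= g1 g2] : torus_rel (1, 0) (0, 0 : R).
  by rewrite /torus_rel /= !subr0 rpred0 rpred1.
have /lat/andP[/= g3 _] : torus_rel (0, 1) (0, 0 : R).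
  by rewrite /torus_rel /= !subr0 rpred0 rpred1.
rewrite -/s !(mulr0, mulr1, mul0r, oppr0, subr0, sub0r, mulNr) in g1 g2 g3.
rewrite rpredN in g2; rewrite addr0 rpredN in g3.
have nat_of (x : R) : 0 < x -> x \is a Num.int -> exists k : nat, x = k%:R.
  by move=> x0 xZ; apply/natrP; rewrite natrEint xZ ltW.
have [|m mE] := nat_of _ _ g1; first by rewrite divr_gt0.
have [|n nE] := nat_of _ _ g3; first by rewrite divr_gt0.
have [|p pE] := nat_of _ _ g2; first by rewrite !divr_gt0 ?exprn_gt0.
have sN0 := gt_eqF s0; have cN0 := gt_eqF c0.
exists m, n, p; split; last by rewrite -mE -nE; field; rewrite sN0.
have d : (m ^ 2 = (n * p).+1)%N.
  apply/eqP; rewrite -(eqr_nat R) -natr1 natrM natrX -mE -nE -pE.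
  rewrite addrC -subr_eq; apply/eqP.
  transitivity ((1 - V ^+ 2 / c ^+ 2) / s ^+ 2); last first.
    by rewrite -s2 divff // sqrf_eq0 sN0.
  by field; rewrite sN0 cN0.
have n0 : (0 < n)%N by rewrite -(ltr_nat R) -nE divr_gt0.
have p0 : (0 < p)%N by rewrite -(ltr_nat R) -pE !divr_gt0 ?exprn_gt0.
split; first by split=> //; [lia | rewrite -ltn_sqr d; nia].
rewrite -nE -pE (_ : _ / _ = c ^+ 2); last first.
  by field; rewrite sN0 cN0 gt_eqF.
by rewrite sqrtr_sqr gtr0_norm.
Qed.

(** * Triples and spectrum of a fixed c *)

Lemma triples_of_pell (R : realType) (c : R) t1 t : triples_of c t1 ->
  triples_of c t <-> is_triple t /\ pell_solution t1 t.
Proof.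
case: t1 t => [[m1 n1] p1] [[m n] p] [[_ _ n1_0 p1_0] cE].
have p1N : p1%:R != 0 :> R by rewrite pnatr_eq0 -lt0n.
split=> [[T cE']|[T [_ q]]]; split=> //; case: (T) => _ _ n_0 p_0;
  have pN : p%:R != 0 :> R by rewrite pnatr_eq0 -lt0n.
  case/is_tripleE: T => e _; split=> //.
  apply/eqP; rewrite -(eqr_nat R) !natrM -eqr_div //.
  by rewrite -eqr_sqrt ?divr_ge0 ?ler0n // cE cE'.
by rewrite -cE; congr Num.sqrt; apply/eqP; rewrite eqr_div // -!natrM q.
Qed.

(** Strong induction on p by [triple_descent].  The descent ends at p <= p1,
    where minimality gives p = p1: since n is proportional to p and
    m^2 = n p + 1, a solution with p < p1 would be below t1 in all three
    entries. *)
Lemma triples_of_pow (R : realType) (c : R) t1 : minimal_triple c t1 ->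
  forall t, triples_of c t <-> exists k, t = triple_pow t1 k.+1.
Proof.
move=> [C1 minC1]; have [T1 S1] := (triples_of_pell t1 C1).1 C1.
move=> t; split=> [Ct|[k ->]]; last first.
  apply/(triples_of_pell _ C1); split; first exact: is_triple_pow.
  exact: pell_solution_pow.
have [b] := ubnP t.2; elim: b t Ct => // b IH t Ct tb.
have [T S] := (triples_of_pell t C1).1 Ct.
case: (ltnP t1.2 t.2) => [lt1t|let1].
  have [t' [T' S' lt' ->]] := triple_descent T1 T S lt1t.
  have [||k ->] := IH t'; first exact/(triples_of_pell _ C1).
    exact: leq_trans lt' tb.
  by exists k.+1.
exists 0%N; rewrite /triple_pow /=.
case: t1 t C1 minC1 T1 S1 {Ct tb IH} T S let1
  => [[m1 n1] p1] [[m n] p] C1 minC1 T1 [e1 _] T [e q] /= lep.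
have [_ _ n1_0 p1_0] := T1.
have pE : p = p1.
  apply/eqP; rewrite eqn_leq lep leqNgt /=; apply/negP => ltp.
  have ltn : (n < n1)%N by rewrite -(ltn_pmul2r p1_0) q ltn_pmul2l.
  have ltm : (m < m1)%N.
    by rewrite -ltn_sqr e e1 ltnS (leq_ltn_trans _ (_ : n * p1 < _)%N)
      ?leq_mul2l ?(ltnW ltp) ?orbT // ltn_pmul2r.
  by apply: (minC1 (m, n, p)) => //; apply/(triples_of_pell _ C1).
have nE : n = n1 by apply/eqP; rewrite -(eqn_pmul2r p1_0) q pE.
have mE : m = m1 by apply/eqP; rewrite -eqn_sqr e e1 nE pE.
by rewrite mE nE pE !muln1 !muln0 !addn0.
Qed.

Definition speed (R : realType) (t : nat * nat * nat) : R :=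
  t.1.2%:R / t.1.1%:R.

(** With (m', n', p') the product, n' m - n m' = n1 (m^2 - n p) = n1 > 0. *)
Lemma speed_lt_mul (R : realType) t1 t : is_triple t1 -> pell_solution t1 t ->
  (0 < t.1.1)%N -> speed R t < speed R (triple_mul t1 t).
Proof.
case: t1 t => [[m1 n1] p1] [[m n] p] T1 [e q] m0.
have [_ m1_2 n1_0 p1_0] := T1; rewrite /speed /=.
have m1_0 : (0 < m1)%N by exact: ltnW.
rewrite ltr_pdivrMr ?ltr0n // mulrAC ltr_pdivlMr ?ltr0n; last first.
  by rewrite addn_gt0 muln_gt0 m1_0 m0.
rewrite -!natrM ltr_nat.
suff -> : ((m1 * n + n1 * m) * m = n * (m1 * m + n1 * p) + n1)%N by lia.
transitivity (m1 * n * m + n1 * m ^ 2)%N; first by rewrite -mulnn; lia.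
by rewrite e; nia.
Qed.

Lemma positive_spectrum_pow (R : realType) (c : R) t1 : minimal_triple c t1 ->
  forall V, (spectrum c V /\ 0 < V) <->
    exists k, V = speed R (triple_pow t1 k.+1).
Proof.
move=> t1min V; split=> [[/[swap] V0 /(admissible_triple V0)]|[k ->]].
  move=> [m [n [p [/(triples_of_pow t1min)[k tk] ->]]]].
  by exists k; rewrite -tk.
have : triples_of c (triple_pow t1 k.+1) by apply/(triples_of_pow t1min); exists k.
case: (triple_pow t1 k.+1) => [[m n] p] C; split.
  by have [_ _ /(_ false)] := triple_admissible C; rewrite mul1r.
by case: C => -[_ m2 n0 _] _; rewrite divr_gt0 ?ltr0n // ltnW.
Qed.

Theorem mainTheorem4 (R : realType) (c : R) (m1 n1 p1 : nat)
    (m n p : nat -> R)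
    (c_admissible : admissible c)
    (t1_minimal : minimal_triple c (m1, n1, p1))
    (m_0 : m 0%N = 1) (p_0 : p 0%N = 0)
    (m_rec : forall k : nat, (1 <= k)%N ->
       m k = m1%:R * m k.-1 + c ^+ 2 * p1%:R * p k.-1)
    (p_rec : forall k : nat, (1 <= k)%N ->
       p k = m1%:R * p k.-1 + p1%:R * m k.-1)
    (n_def : forall k : nat, (1 <= k)%N ->
       n k = (m k ^+ 2 - 1) / p k) :
  forall k : nat, (1 <= k)%N ->
    exists mk nk pk : nat,
      [/\ m k = mk%:R, n k = nk%:R & p k = pk%:R] /\
      [/\ kth_triple c k (mk, nk, pk),
          corresponds (mk, nk, pk) (n k / m k) c &
          kth_spectrum_term c k (- (n k / m k), n k / m k)].
Proof.
  move=> k k1.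
have [C1 _] := t1_minimal; have [T1 S1] := (triples_of_pell _ C1).1 C1.
have [c0 c2 _] := triple_admissible C1.
have [_ _ n1_0 p1_0] := T1.
set t1 := (m1, n1, p1) in t1_minimal C1 T1 S1 *.
have mpE j : m j = (triple_pow t1 j).1.1%:R /\ p j = (triple_pow t1 j).2%:R.
  elim: j => [|j [mj pj]]; first by rewrite m_0 p_0.
  rewrite (m_rec j.+1) // (p_rec j.+1) // mj pj [triple_pow t1 j.+1]iterS.
  rewrite -/(triple_pow t1 j); case: (triple_pow t1 j) => [[m' n'] p'] /=; rewrite !natrD !natrM c2.
  by split=> //; rewrite divfK // pnatr_eq0 -lt0n.
case: k k1 => // k _; have [mk pk] := mpE k.+1; have nk := n_def k.+1 isT.
have Ck : triples_of c (triple_pow t1 k.+1).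
  by apply/(triples_of_pow t1_minimal); exists k.
have VkE : kth_positive c k.+1 (speed R (triple_pow t1 k.+1)).
  apply: (@kth_element_enum _ _ _ (fun j => speed R (triple_pow t1 j.+1))).
  - by move=> x; rewrite ltxx.
  - by move=> y x z; exact: lt_trans.
  - move=> j; apply: speed_lt_mul => //; last exact: triple_pow_gt0.
    exact: pell_solution_pow.
  - exact: positive_spectrum_pow.
have tkE : kth_element triple_lt (triples_of c) k.+1 (triple_pow t1 k.+1).
  apply: (@kth_element_enum _ _ _ (fun j => triple_pow t1 j.+1)).
  - exact: triple_lt_irr.
  - exact: triple_lt_trans.
  - by move=> j; exact: triple_lt_pow.
  - exact: triples_of_pow.
case: (triple_pow t1 k.+1) mk pk Ck VkE tkE => [[mk' nk'] pk'] /= mk pk Ck VkE tkE.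
have [[e m2 n0 p0] _] := Ck.
have nkE : n k.+1 = nk'%:R.
  rewrite nk mk pk -natrX (_ : (mk' ^ 2 = (nk' * pk').+1)%N); last by lia.
  by rewrite -natr1 addrK natrM mulfK // pnatr_eq0 -lt0n.
exists mk', nk', pk'; split; first by [].
have corr : corresponds (mk', nk', pk') (n k.+1 / m k.+1) c.
  by split=> //; rewrite nkE mk.
have VE : n k.+1 / m k.+1 = nk'%:R / mk'%:R by rewrite nkE mk.
split=> //; first by split=> //; exists (n k.+1 / m k.+1); rewrite {1}VE.
rewrite VE; split=> //=; have [_ _ /(_ true)] := triple_admissible Ck.
by rewrite mulN1r.
Qed.
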